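(* Let $A$, $B$, $C$ be $m \times n$ matrices over $\{-1,0,1\}$ such that $A$ has an entry $0$ and $(A,B,C)$ is neither independent from $B$ nor independent from $C$. Suppose $A$ is not a layered matrix but $B$ and $C$ are layered matrices. Then ${\rm IST}(A,B,C)=\infty$ if and only if one of the following holds: (a) $(A,B,C)$ is left-$0$-invariant; (b) $(A,B,C)$ is right-$0$-invariant; (c) there is $p\in\{1,2,\dots,n-2\}$ such that every row of $A$ equals $1^p0(-1)^{n-p-1}$, $B$ is the all-$1$ matrix and $C$ is the all-$(-1)$ matrix.
   Context: Rows of matrices are written as strings; $x^r$ denotes the symbol $x$ repeated $r$ times. For an $m\times n$ matrix $M=[m_{ij}]$ over $\{-1,0,1\}$, $G_o(M)$ is the directed graph on $\{1,\dots,n+m\}$ with edges $j\to i$ for all $1\le j<i\le n$, and for $1\le p\le m$, $1\le j\le n$: an edge $j\to n+p$ if $m_{pj}=1$, an edge $n+p\to j$ if $m_{pj}=-1$, no edge if $m_{pj}=0$; no edges among $n+1,\dots,n+m$. A directed graph is semi-transitive if it is acyclic and for every directed path $u_1\to\cdots\to u_t$, $t\ge2$, either there is no edge $u_1\to u_t$ or all edges $u_i\to u_j$ ($1\le i<j\le t$) exist. For $m\times n$ matrices $A,B,C$ over $\{-1,0,1\}$, the morphism $\varphi$ replaces each entry $0,1,-1$ by the block $A,B,C$ respectively; $M^k(A,B,C)=\varphi^k([0])$ and $G_o^k(A,B,C)=G_o(M^k(A,B,C))$. If $A$ has an entry $0$, ${\rm IST}(A,B,C)$ is the least $\ell\ge0$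 with $G_o^\ell(A,B,C)$ not semi-transitive, or $\infty$ if none exists. A matrix is layered if all entries in each row are identical. $(A,B,C)$ is independent from $B$ if there are no $1$'s in $A$ and $C$; it is independent from $C$ if there are no $(-1)$'s in $A$ and $B$. $(A,B,C)$ is left-$0$-invariant if: every row of $A$ is in $\{01^{n-1},1^n,0(-1)^{n-1},(-1)^n\}$; every row of $B$ and of $C$ is in $\{1^n,(-1)^n\}$; if $01^{n-1}$ is a row of $A$, then for every $i$, row $i$ of $B$ is $1^n$ when row $i$ of $A$ is $01^{n-1}$ or $1^n$, and row $i$ of $B$ is $(-1)^n$ when row $i$ of $A$ is $0(-1)^{n-1}$ or $(-1)^n$; and if $0(-1)^{n-1}$ is a row of $A$, then the same implications hold with $C$ in place of $B$. $(A,B,C)$ is right-$0$-invariant if: every row of $A$ is in $\{1^{n-1}0,1^n,(-1)^{n-1}0,(-1)^n\}$; every row of $B$ and of $C$ is in $\{1^n,(-1)^n\}$; if $1^{n-1}0$ is a row of $A$, then for every $i$, row $i$ of $B$ is $1^n$ when row $i$ of $A$ is $1^{n-1}0$ or $1^n$, and row $i$ of $B$ is $(-1)^n$ when row $i$ of $A$ is $(-1)^{n-1}0$ or $(-1)^n$; and if $(-1)^{n-1}0$ is a row of $A$, then the same implications hold with $C$ in place of $B$. *)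

(* Defs.v *)
From mathcomp Require Import all_boot all_order all_algebra.
From mathcomp Require Import boolp mxtens.

Set Implicit Arguments.
Unset Strict Implicit.
Unset Printing Implicit Defensive.

Import GRing.Theory.
Local Open Scope ring_scope.

Definition ternary m n (M : 'M[int]_(m, n)) : Prop :=
  forall i j, M i j \in [:: -1; 0; 1].

Section Digraph.
Variables (V : finType) (e : rel V).

(* A closed walk is a sequence c all of whose cyclically consecutive entries
   are edges; loops and 2-cycles are included. *)
Definition acyclic : Prop := forall c : seq V, cycle e c -> c = [::].

(* The path u_1 -> ... -> u_t is x :: p, so that t >= 2 means 0 < size p. *)
Definition semi_transitive : Prop :=
  acyclic /\
  forall (x : V) (p : seq V), (0 < size p)%N -> path e x p ->
    ~~ e x (last x p) \/ pairwise e (x :: p).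

End Digraph.

(* Vertices are numbered from 0: the j-th column is lshift m j (value j) and
   the p-th row is rshift n p (value n + p). *)
Definition Go m n (M : 'M[int]_(m, n)) : rel 'I_(n + m) := fun u v =>
  match split u, split v with
  | inl j, inl i => (j < i)%N
  | inl j, inr p => M p j == 1
  | inr p, inl j => M p j == -1
  | inr _, inr _ => false
  end.

Section Morphism.
Variables (m n : nat) (A B C : 'M[int]_(m, n)).

(* On ternary matrices the last case is the entry -1. *)
Definition image_block (x : int) : 'M[int]_(m, n) :=
  if x == 0 then A else if x == 1 then B else C.

(* mxtens_unindex k = (k %/ m, k %% m) for k : 'I_(p * m): block index, then
   position inside the block. *)
Definition phi p q (X : 'M[int]_(p, q)) : 'M[int]_(p * m, q * n) :=
  \matrix_(i, j)
    image_block (X (mxtens_unindex i).1 (mxtens_unindex j).1)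
      (mxtens_unindex i).2 (mxtens_unindex j).2.

(* powdim d k is d ^ k, written so that powdim d k.+1 computes to powdim d k * d. *)
Fixpoint powdim (d k : nat) : nat := if k is k'.+1 then (powdim d k' * d)%N else 1%N.

Fixpoint Mpow (k : nat) : 'M[int]_(powdim m k, powdim n k) :=
  if k is k'.+1 then phi (Mpow k') else const_mx 0.

Definition Gok (k : nat) : rel 'I_(powdim n k + powdim m k) := Go (Mpow k).

Definition not_semi_transitive_at (l : nat) : bool :=
  `[< ~ semi_transitive (@Gok l) >].

(* None stands for infinity. *)
Definition IST : option nat :=
  match pselect (exists l, not_semi_transitive_at l) with
  | left ex_l => Some (ex_minn ex_l)
  | right _ => None
  end.

Definition independent_from_B : Prop :=
  (forall i j, A i j <> 1) /\ (forall i j, C i j <> 1).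

Definition independent_from_C : Prop :=
  (forall i j, A i j <> -1) /\ (forall i j, B i j <> -1).

End Morphism.

Lemma powdimE d k : powdim d k = (d ^ k)%N.
Proof. by elim: k => //= k ->; rewrite expnSr. Qed.

Definition layered m n (M : 'M[int]_(m, n)) : Prop :=
  forall i j j', M i j = M i j'.

Definition row_string m n (M : 'M[int]_(m, n)) (i : 'I_m) : seq int :=
  [seq M i j | j <- enum 'I_n].

Section Invariance.
Variables (m n : nat) (A B C : 'M[int]_(m, n)).

(* In this section z x is the string of length n with a single 0 at a
   prescribed end and all other symbols equal to x. *)
Definition sign_compatible (z : int -> seq int) (D : 'M[int]_(m, n)) : Prop :=
  forall i,
    (row_string A i \in [:: z 1; nseq n 1] ->
       row_string D i = nseq n 1) /\
    (row_string A i \in [:: z (-1); nseq n (-1)] ->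
       row_string D i = nseq n (-1)).

Definition zero_invariant (z : int -> seq int) : Prop :=
  [/\ forall i, row_string A i \in [:: z 1; nseq n 1; z (-1); nseq n (-1)],
      forall i, row_string B i \in [:: nseq n 1; nseq n (-1)],
      forall i, row_string C i \in [:: nseq n 1; nseq n (-1)],
      (exists i, row_string A i = z 1) -> sign_compatible z B
    & (exists i, row_string A i = z (-1)) -> sign_compatible z C].

Definition left_zero_invariant : Prop :=
  zero_invariant (fun x => 0 :: nseq n.-1 x).

Definition right_zero_invariant : Prop :=
  zero_invariant (fun x => rcons (nseq n.-1 x) 0).

End Invariance.

(* Main.v *)
(* Semi-transitivity of [Go M] forces each row of [M] to be [0^a x^b 0^c] with
   [x = 1] or [x = -1], or [1^a 0^b (-1)^c], and restricts which rows may occur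
   together ([good]).  A row with two zeros would give, one step later, two
   copies of a non-constant row of [A] in the same row, so no power has such a
   row; hence [B] and [C] have no zeros either, since a zero row of [B] or [C]
   would be copied next to itself.  If row [i0] of [A] has its only zero at
   position [z], row [(i0, r)] of the second power is row [r] of [A] surrounded
   by constant blocks given by [B] and [C].  Comparing these rows with row
   [(i0, i0)] and rows [(r, i0)] shows that every row of [A] is constant or has
   its zero at the same end as [i0] when [z] is an end (the right end follows
   from the left one by reversing all edges), and that all rows of [A] are equal
   otherwise.

   Conversely, each of the three shapes is preserved by the morphism.  In the
   first two all rows are pure and convex; in the third [Go M] is the strict
   order of a rank function. *)
Require Import Defs.
From mathcomp Require Import all_boot all_order all_algebra.
From mathcomp Require Import boolp mxtens zify.

Set Implicit Arguments.
Unset Strict Implicit.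
Unset Printing Implicit Defensive.

Import GRing.Theory.
Local Open Scope ring_scope.

Definition is_sign (x : int) : Prop := x = 1 \/ x = -1.

Lemma is_sign_neq0 x : is_sign x -> x <> 0.
Proof. by case=> ->. Qed.

Lemma is_signN x : is_sign x -> is_sign (- x).
Proof. by case=> ->; [right | left]; rewrite ?opprK. Qed.

(** * Rank functions on digraphs *)

Section Digraph.
Variables (V : finType) (e : rel V) (r : V -> nat).

Lemma acyclic_rank : (forall u v, e u v -> (r u < r v)%N) -> acyclic e.
Proof.
move=> er [|x s] //= es.
have {}es: path (relpre r ltn) x (rcons s x) by apply: sub_path es.
have /order_path_min := es => /(_ (fun _ _ _ => @ltn_trans _ _ _)).
by rewrite all_rcons /= ltnn.
Qed.

Lemma semi_transitive_rank :
  (forall u v, e u v = (r u < r v)%N) -> semi_transitive e.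
Proof.
move=> er; split; first by apply: acyclic_rank => u v; rewrite er.
move=> x p _ xp; right; rewrite -sorted_pairwise //.
by move=> u v w; rewrite !er; apply: ltn_trans.
Qed.

End Digraph.

(** * Sufficient and necessary conditions for semi-transitivity of [Go M] *)

Section Go.
Variables (m n : nat) (M : 'M[int]_(m, n)).

Lemma Go_cc (i j : 'I_n) : Go M (lshift m i) (lshift m j) = (i < j)%N.
Proof. by rewrite /Go (unsplitK (inl i)) (unsplitK (inl j)). Qed.

Lemma Go_cr (j : 'I_n) (p : 'I_m) : Go M (lshift m j) (rshift n p) = (M p j == 1).
Proof. by rewrite /Go (unsplitK (inl j)) (unsplitK (inr p)). Qed.

Lemma Go_rc (j : 'I_n) (p : 'I_m) : Go M (rshift n p) (lshift m j) = (M p j == -1).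
Proof. by rewrite /Go (unsplitK (inl j)) (unsplitK (inr p)). Qed.

Lemma Go_rr (p q : 'I_m) : Go M (rshift n p) (rshift n q) = false.
Proof. by rewrite /Go (unsplitK (inr p)) (unsplitK (inr q)). Qed.

Definition GoE := (Go_cc, Go_cr, Go_rc, Go_rr).

(** A pure row is a source or a sink, so the inner vertices of a path are columns, which are
    pairwise joined. Convexity supplies the missing edges between these columns and an end of the
    path that is a row. *)
Lemma Go_pure_convex_semi_transitive :
    (forall p, exists y, [/\ is_sign y, forall j, M p j = 0 \/ M p j = y
      & forall i j k : 'I_n, (i < j < k)%N ->
          M p i = y -> M p k = y -> M p j = y]) ->
  semi_transitive (Go M).
Proof.
move=> pureM.
have pure p i j : M p i = 1 -> M p j = -1 -> False.
  have [y [y_sign M0 _]] := pureM p => Mi Mj; have := M0 j; have := M0 i.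
  by rewrite Mi Mj; case: y_sign => -> [|] // _ [|].
have convex p (y : int) (i j k : 'I_n) : is_sign y -> (i <= j <= k)%N ->
    M p i = y -> M p k = y -> M p j = y.
  move=> y_sign /andP[]; rewrite leq_eqVlt => /orP[/eqP/val_inj <- // | ij].
  rewrite leq_eqVlt => /orP[/eqP/val_inj <- // | jk] Mi Mk.
  have [z [_ M0 convM]] := pureM p.
  have zy : z = y.
    by case: (M0 i); rewrite Mi // => y0; case: (is_sign_neq0 y_sign).
  by rewrite -zy; apply: (convM i j k); rewrite ?ij ?jk ?zy.
(* Columns keep their order with ranks from 1 to [n]; rows with outgoing edges go below them, all
   other rows above. *)
pose rk (u : 'I_(n + m)) :=
  match split u with
  | inl j => j.+1
  | inr p => if [exists j, M p j == -1] then 0%N else n.+1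
  end.
have rkc j : rk (lshift m j) = j.+1 by rewrite /rk (unsplitK (inl j)).
have rkP u v : Go M u v -> (rk u < rk v)%N.
  case: (split_ordP u) => [i ->|p ->]; case: (split_ordP v) => [j ->|q ->];
    rewrite !GoE ?rkc // /rk (unsplitK (inr _)).
    move=> /eqP Mqi; case: ifP => [/existsP[j /eqP Mqj]|_]; last first.
      by rewrite ltnS ltn_ord.
    by case: (pure _ _ _ Mqi Mqj).
  by move=> Mpj; rewrite ifT //; apply/existsP; exists j.
split; first exact: acyclic_rank rkP.
move=> x p; case/lastP: p => // p y _; rewrite last_rcons => xpy.
have [exy|] := boolP (Go M x y); [right | by left].
(* An inner vertex has both an incoming and an outgoing edge; a row with both would contain both
   signs. *)
have {exy xpy} : exists2 q : seq 'I_n, p = map (@lshift n m) q &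
    path (Go M) x (rcons (map (@lshift n m) q) y) /\ Go M x y.
  suff [q def_p] : exists q : seq 'I_n, p = map (@lshift n m) q.
    by exists q => //; rewrite -def_p.
  elim: p x {exy} xpy => [|u p IHp] x /=; first by exists [::].
  move=> /andP[xu upy]; have [q ->] := IHp _ upy.
  case: (split_ordP u) => [i ->|r def_u]; first by exists (i :: q).
  have : exists v, Go M u v.
    by case: p upy {IHp} => [|v p] /= /andP[uv _]; [exists y | exists v].
  rewrite def_u in xu *; case=> v.
  case: (split_ordP v) => [j ->|r' ->]; case: (split_ordP x) xu => [i ->|p' ->];
    rewrite !GoE // => /eqP Mi /eqP Mj.
  by case: (pure _ _ _ Mi Mj).
case=> q ->{p} [xqy xy].
have rk_path : path (relpre rk ltn) x (rcons (map (@lshift n m) q) y).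
  by apply: sub_path xqy.
have rkT : transitive (relpre rk ltn) by move=> ? ? ?; apply: ltn_trans.
have : pairwise (relpre rk ltn) (x :: rcons (map (@lshift n m) q) y).
  by rewrite -sorted_pairwise.
rewrite /= !pairwise_rcons !all_rcons => /and3P[/andP[_ rk_xq] rk_qy rk_q].
rewrite xy /=; apply/and3P; split; last first.
- by move: rk_q; rewrite !pairwise_map; apply: sub_pairwise => i j /=; rewrite !GoE !rkc.
(* If [y] is a row, then [x] is a column, and [i] lies between [x] and the last inner column; row
   [y] has a 1 at both. *)
- apply/allP => _ /mapP[i iq ->].
  have := allP rk_qy _ (map_f _ iq); case: (split_ordP y) => [j def_y|r def_y].
    by rewrite def_y GoE /= !rkc.
  rewrite {}def_y in xqy xy {rk_qy rk_path} *; rewrite Go_cr => _.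
  case: (split_ordP x) xy => [h def_x|r' ->]; last by rewrite GoE.
  have := allP rk_xq _ (map_f _ iq); rewrite def_x GoE /= !rkc ltnS => hi /eqP Mh.
  case/lastP: q iq rk_q xqy {rk_xq} => // q l iq rk_q.
  rewrite map_rcons rcons_path last_rcons GoE => /andP[_ /eqP Ml]; apply/eqP.
  apply: (convex _ _ h i l (or_introl (erefl _)) _ Mh Ml).
  rewrite (ltnW hi) /=; move: iq; rewrite mem_rcons inE => /orP[/eqP -> //|iq].
  move: rk_q; rewrite map_rcons pairwise_rcons => /andP[/allP/(_ _ (map_f _ iq))].
  by rewrite /= !rkc ltnS => /ltnW.
- apply/allP => _ /mapP[i iq ->].
  have := allP rk_xq _ (map_f _ iq); case: (split_ordP x) => [j def_x|r def_x].
    by rewrite def_x GoE /= !rkc.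
  rewrite {}def_x in xqy xy {rk_xq rk_path} *; rewrite Go_rc => _.
  case: (split_ordP y) xy => [h def_y|r' ->]; last by rewrite GoE.
  have := allP rk_qy _ (map_f _ iq); rewrite def_y GoE /= !rkc ltnS => hi /eqP Mh.
  case: q iq rk_q xqy {rk_qy} => // l q iq rk_q.
  rewrite /= GoE => /andP[/eqP Ml _]; apply/eqP.
  apply: (convex _ _ l i h (or_intror (erefl _)) _ Ml Mh).
  rewrite (ltnW hi) andbT; move: iq; rewrite inE => /orP[/eqP -> //|iq].
  move: rk_q => /= /andP[/allP/(_ _ (map_f _ iq))].
  by rewrite /= !rkc ltnS => /ltnW.
Qed.

(** Columns are ranked by position and all rows share the rank [s]; [Go M] is then exactly the
    strict order of ranks. *)
Lemma Go_const_rows_semi_transitive s :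
    (forall p (j : 'I_n), M p j = if (j < s)%N then 1 else if j == s :> nat then 0 else -1) ->
  semi_transitive (Go M).
Proof.
move=> defM.
pose rk (u : 'I_(n + m)) := if split u is inl j then nat_of_ord j else s.
apply: (@semi_transitive_rank _ _ rk) => u v; rewrite /rk.
case: (split_ordP u) => [i ->|p ->]; case: (split_ordP v) => [j ->|q ->];
  rewrite !GoE ?(unsplitK (inl _)) ?(unsplitK (inr _)) ?defM ?ltnn //;
  by case: ltngtP.
Qed.

(* A row is called pure if its nonzero entries have the same sign, and mixed
   if both signs occur. *)
Record good : Prop := Good {
  good_decr : forall p (i j : 'I_n), (i < j)%N -> M p i = -1 -> M p j = 1 -> False;
  good_convex : forall p (i j k : 'I_n) y, is_sign y -> (i < j)%N -> (j < k)%N ->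
    M p i = y -> M p k = y -> M p j = y;
  good_prefix : forall p (i j k : 'I_n), (i < j)%N -> (j < k)%N ->
    M p j = 1 -> M p k = -1 -> M p i = 1;
  good_suffix : forall p (i j k : 'I_n), (i < j)%N -> (j < k)%N ->
    M p i = 1 -> M p j = -1 -> M p k = -1;
  good_mixed_pure : forall p q (i j : 'I_n) y, is_sign y ->
    M p i = 1 -> M p j = -1 -> M q i = y -> M q j = y -> False;
  good_mixed_mixed : forall p q (i j k l : 'I_n), (j <= k)%N ->
    M p i = 1 -> M p j = -1 -> M q k = 1 -> M q l = -1 -> False
}.

(** [good_decr] excludes a directed triangle. Every other field comes from one path whose ends are
    joined, so that all its vertices must be joined; when the path visits two rows this is absurd,
    since rows are never adjacent. *)
Lemma semi_transitive_good : semi_transitive (Go M) -> good.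
Proof.
case=> acyc st.
have decr p (i j : 'I_n) : (i < j)%N -> M p i = -1 -> M p j = 1 -> False.
  move=> ij Mi Mj.
  by have := acyc [:: lshift m i; lshift m j; rshift n p];
    rewrite /= !GoE ij Mi Mj !eqxx => /(_ isT).
have lt_1N p (i j : 'I_n) : M p i = 1 -> M p j = -1 -> (i < j)%N.
  move=> Mi Mj; case: ltngtP => [//|ji|/val_inj eq_ij].
    by case: (decr p j i).
  by move: Mj; rewrite -eq_ij Mi.
have shortcut x s : (0 < size s)%N -> path (Go M) x s -> Go M x (last x s) ->
    pairwise (Go M) (x :: s).
  by move=> s0 xs xl; case: (st x s s0 xs) => //; rewrite xl.
split=> //.
- move=> p i j k y [] -> ij jk Mi Mk.
    have := shortcut (lshift m i) [:: lshift m j; lshift m k; rshift n p].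
    by rewrite /= !GoE ij jk Mi Mk eqxx => /(_ isT isT isT) /and4P[_ /and3P[_ /eqP]].
  have := shortcut (rshift n p) [:: lshift m i; lshift m j; lshift m k].
  by rewrite /= !GoE ij jk Mi Mk eqxx => /(_ isT isT isT) /and4P[/and4P[_ /eqP]].
- move=> p i j k ij jk Mj Mk.
  have := shortcut (lshift m i) [:: lshift m j; rshift n p; lshift m k].
  rewrite /= !GoE ij Mj Mk (ltn_trans ij jk) eqxx => /(_ isT isT isT).
  by move=> /and4P[/and4P[_ /eqP]].
- move=> p i j k ij jk Mi Mj.
  have := shortcut (lshift m i) [:: rshift n p; lshift m j; lshift m k].
  rewrite /= !GoE jk Mi Mj (ltn_trans ij jk) eqxx => /(_ isT isT isT).
  by move=> /and4P[_ /and3P[_ /eqP]].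
- move=> p q i j y [] -> Mi Mj Nqi Nqj; have ij := lt_1N _ _ _ Mi Mj.
    have := shortcut (lshift m i) [:: rshift n p; lshift m j; rshift n q].
    by rewrite /= !GoE Mi Mj Nqi Nqj eqxx !andbF => /(_ isT isT isT).
  have := shortcut (rshift n q) [:: lshift m i; rshift n p; lshift m j].
  by rewrite /= !GoE Mi Mj Nqi Nqj eqxx !andbF => /(_ isT isT isT).
move=> p q i j k l; rewrite leq_eqVlt => jk Mi Mj Mk Ml.
have ij := lt_1N _ _ _ Mi Mj; have kl := lt_1N _ _ _ Mk Ml.
case/orP: jk => [/eqP/val_inj eq_jk|jk].
  rewrite {}eq_jk in Mj ij.
  have := shortcut (lshift m i) [:: rshift n p; lshift m k; rshift n q; lshift m l].
  by rewrite /= !GoE Mi Mj Mk Ml (ltn_trans ij kl) eqxx !andbF => /(_ isT isT isT).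
have := shortcut (lshift m i)
  [:: rshift n p; lshift m j; lshift m k; rshift n q; lshift m l].
rewrite /= !GoE Mi Mj Mk Ml jk (ltn_trans ij (ltn_trans jk kl)) eqxx !andbF.
by move=> /(_ isT isT isT).
Qed.

End Go.

(** * Submatrices and reversed orientation *)

Section GoodTransport.
Variables (m n : nat) (M : 'M[int]_(m, n)).

(** The conditions only compare columns by their order, so a strictly increasing column map
    suffices, and the row map is arbitrary. *)
Lemma good_submatrix m' n' (M' : 'M[int]_(m', n')) (g : 'I_m' -> 'I_m)
    (f : 'I_n' -> 'I_n) :
    (forall i j, (f i < f j)%N = (i < j)%N) -> (forall p j, M' p j = M (g p) (f j)) ->
  good M -> good M'.
Proof.
move=> f_lt defM' [dM cM pM sM mpM mmM].
have f_le (i j : 'I_n') : (i <= j)%N -> (f i <= f j)%N by rewrite leqNgt -f_lt -leqNgt.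
split=> [p i j|p i j k y|p i j k|p i j k|p q i j y|p q i j k l].
- by rewrite !defM' -f_lt; apply: dM.
- by rewrite !defM' -!f_lt; apply: cM.
- by rewrite !defM' -!f_lt; apply: pM.
- by rewrite !defM' -!f_lt; apply: sM.
- by rewrite !defM'; apply: mpM.
- by rewrite !defM' => /f_le; apply: mmM.
Qed.

(* Matrix of the reversed orientation of [Go M], with the path on the columns
   renumbered from its other end. *)
Definition reverse_mx : 'M[int]_(m, n) := \matrix_(i, j) - M i (rev_ord j).

(** Reversal exchanges [good_prefix] and [good_suffix] and preserves each of the other
    conditions. *)
Lemma good_reverse : good M -> good reverse_mx.
Proof.
case=> dM cM pM sM mpM mmM.
have rev_lt (i j : 'I_n) : (i < j)%N -> (rev_ord j < rev_ord i)%N.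
  by move=> ij /=; have := ltn_ord j; lia.
have rev_le (i j : 'I_n) : (i <= j)%N -> (rev_ord j <= rev_ord i)%N.
  by move=> ij /=; have := ltn_ord j; lia.
have mxNE p j x : reverse_mx p j = x -> M p (rev_ord j) = - x.
  by rewrite mxE => <-; rewrite opprK.
have mx1 p j : reverse_mx p j = 1 -> M p (rev_ord j) = -1 by apply: mxNE.
have mxN1 p j : reverse_mx p j = -1 -> M p (rev_ord j) = 1.
  by move/mxNE; rewrite opprK.
split=> [p i j /rev_lt ij|p i j k y /is_signN ys /rev_lt ij /rev_lt jk
  |p i j k /rev_lt ij /rev_lt jk|p i j k /rev_lt ij /rev_lt jk
  |p q i j y /is_signN ys|p q i j k l /rev_le jk].
- by move=> /mxN1 Mi /mx1 Mj; apply: (dM p _ _ ij Mj Mi).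
- by move=> /mxNE Mi /mxNE Mk; rewrite mxE (cM p _ _ _ _ ys jk ij) ?opprK.
- by move=> /mx1 Mj /mxN1 Mk; rewrite mxE (sM p _ _ _ jk ij) ?opprK.
- by move=> /mx1 Mi /mxN1 Mj; rewrite mxE (pM p _ _ _ jk ij).
- by move=> /mx1 Mi /mxN1 Mj /mxNE Ni /mxNE Nj; apply: (mpM p q _ _ _ ys Mj Mi Nj Ni).
- move=> /mx1 Mi /mxN1 Mj /mx1 Ni /mxN1 Nj.
  exact: (mmM q p _ _ _ _ jk Nj Ni Mj Mi).
Qed.

End GoodTransport.

Lemma ternaryP m n (A : 'M[int]_(m, n)) i j : ternary A -> A i j = 0 \/ is_sign (A i j).
Proof.
by move=> /(_ i j); rewrite !inE => /or3P[] /eqP ->; [right; right|left|right; left].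
Qed.

Lemma ternary_reverse m n (A : 'M[int]_(m, n)) : ternary A -> ternary (reverse_mx A).
Proof.
move=> tA i j; rewrite mxE.
by have [->|[] ->] := ternaryP i (rev_ord j) tA.
Qed.

Local Notation ix j c := (mxtens_index (j, c)).

(** * Order on block indices *)

Section Blocks.
Variables (N n : nat).
Implicit Types (j : 'I_N) (c : 'I_n).

Lemma ltn_ix_block j j' c c' : (j < j')%N -> (ix j c < ix j' c')%N.
Proof. by move=> jj' /=; have := ltn_ord c; nia. Qed.

Lemma ltn_ix_inner j c c' : (c < c')%N -> (ix j c < ix j c')%N.
Proof. by rewrite /= ltn_add2l. Qed.

Lemma rev_ord_ix j c : rev_ord (ix j c) = ix (rev_ord j) (rev_ord c).
Proof. by apply: val_inj => /=; have := ltn_ord c; have := ltn_ord j; nia. Qed.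

End Blocks.

(** * The morphism: reversal, and uniqueness of zeros in a row *)

Section Substitution.
Variables (m n : nat).
Implicit Types A B C : 'M[int]_(m, n).

Lemma phiE A B C p q (X : 'M[int]_(p, q)) i r j c :
  phi A B C X (ix i r) (ix j c) = image_block A B C (X i j) r c.
Proof. by rewrite mxE !mxtens_indexK. Qed.

Lemma image_block0 A B C : image_block A B C 0 = A.
Proof. by []. Qed.

(** Negating entries swaps 1 and -1, so the blocks [B] and [C] trade places. *)
Lemma image_block_reverse A B C x :
    x = 0 \/ is_sign x ->
  image_block (reverse_mx A) (reverse_mx C) (reverse_mx B) x =
  reverse_mx (image_block A B C (- x)).
Proof. by case=> [->|[] ->]. Qed.

Lemma phi_reverse A B C p q (X : 'M[int]_(p, q)) :
    ternary X ->
  phi (reverse_mx A) (reverse_mx C) (reverse_mx B) (reverse_mx X) =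
  reverse_mx (phi A B C X).
Proof.
move=> tX; apply/matrixP=> i j; case: (mxtens_indexP i) => {}i r.
case: (mxtens_indexP j) => {}j c; rewrite [RHS]mxE rev_ord_ix !phiE.
rewrite image_block_reverse ?mxE ?opprK //.
by have [->|/is_signN] := ternaryP i (rev_ord j) tX; [left; rewrite oppr0 | right].
Qed.

(* Two zeros in a row of [X] produce two copies of every row of [A]; a
   non-constant row cannot be repeated. *)
Lemma good_phi_unique_zero A B C p q (X : 'M[int]_(p, q)) i j j' :
    ternary A -> ~ layered A -> good (phi A B C X) ->
  X i j = 0 -> X i j' = 0 -> j = j'.
Proof.
move=> tA nlA [decr convex _ _ _ _].
wlog jj' : j j' / (j < j')%N => [wlog_lt Xj Xj'|Xj Xj'].
  case: (ltngtP j j') => [jj'|j'j|/val_inj //]; first exact: wlog_lt.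
  by apply/esym/wlog_lt.
case: nlA => r; suff same (c c' : 'I_n) : (c < c')%N -> A r c = A r c'.
  move=> c c'; case: (ltngtP c c') => [/same //|/same //|/val_inj -> //].
move=> cc'; apply: contrapT => neq.
have P c0 : (phi A B C X (ix i r) (ix j c0) = A r c0) *
            (phi A B C X (ix i r) (ix j' c0) = A r c0).
  by rewrite !phiE Xj Xj'.
have lt1 := ltn_ix_inner j cc'; have lt2 := ltn_ix_block c' c jj'.
have lt3 := ltn_ix_inner j' cc'.
have := convex (ix i r) _ _ _ (A r c) _ lt1 lt2.
have := convex (ix i r) _ _ _ (A r c') _ lt2 lt3.
have := decr (ix i r) _ _ lt1; have := decr (ix i r) _ _ lt2.
rewrite !P; have [Ac|Ac] := ternaryP r c tA; have [Ac'|Ac'] := ternaryP r c' tA.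
- by case: neq; rewrite Ac Ac'.
- by move=> _ _ /(_ Ac' erefl erefl).
- by move=> _ _ _ /(_ Ac erefl erefl)/esym.
- case: Ac Ac' neq => -> [] -> // _; first by move=> /(_ erefl erefl).
  by move=> _ /(_ erefl erefl).
Qed.

End Substitution.

(** * Shape of [A] forced by the first two powers *)

Definition zero_end (left : bool) n : nat := if left then 0 else n.-1.

(** The boolean selects the end, so that left and right share their statements. *)
Definition end_zero_row left m n (M : 'M[int]_(m, n)) i y :=
  forall j : 'I_n, M i j = if j == zero_end left n :> nat then 0 else y.

Definition const_row m n (M : 'M[int]_(m, n)) i y := forall j, M i j = y.

Section Necessity.
(** [d y r] is the constant value of row [r] in the block replacing the sign [y]; it treats [B] and
    [C] uniformly. *)
Variables (m n : nat) (A B C : 'M[int]_(m, n)) (d : int -> 'I_m -> int).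
Hypotheses (n_gt1 : (1 < n)%N) (tA : ternary A).
Hypothesis blockE :
  forall y r c, is_sign y -> image_block A B C y r c = d y r.
Hypothesis d_sign : forall y r, is_sign y -> is_sign (d y r).
Hypothesis zero_unique : forall i j j', A i j = 0 -> A i j' = 0 -> j = j'.
Hypotheses (gA : good A) (gA2 : good (phi A B C A)).

Let phi0E i r j c : A i j = 0 -> phi A B C A (ix i r) (ix j c) = A r c.
Proof. by move=> Aij; rewrite phiE Aij. Qed.

Let phi_signE i r j c y :
  is_sign y -> A i j = y -> phi A B C A (ix i r) (ix j c) = d y r.
Proof. by move=> ys Aij; rewrite phiE Aij blockE. Qed.

Let col0 : 'I_n := Ordinal (ltnW n_gt1).
Let col1 : 'I_n := Ordinal n_gt1.

(** Row [(i0, r)] of [phi A B C A] is row [r] of [A] followed by blocks constantly equal to [d x r].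
    Decrease and convexity settle most cases; a row [r] starting with 1 while [d x r = -1] is
    refuted through rows [(i0, i0)] and [(r, i0)]. *)
Lemma first_zero_rows x i0 :
    is_sign x -> end_zero_row true A i0 x ->
  forall r, end_zero_row true A r (d x r) \/ const_row A r (d x r).
Proof.
move=> xs Ai0 r; have [decr convex prefix _ mixed_pure _] := gA2.
have Ai00 : A i0 col0 = 0 by rewrite Ai0.
have Ai01 : A i0 col1 = x by rewrite Ai0.
have rowi0 s c : phi A B C A (ix i0 s) (ix col0 c) = A s c by apply: phi0E.
have rowi1 s c : phi A B C A (ix i0 s) (ix col1 c) = d x s by apply: phi_signE.
have lt01 (c c' : 'I_n) : (ix col0 c < ix col1 c')%N by apply: ltn_ix_block.
suff no_neg j : A r j <> - d x r.
  have A0d j : A r j = 0 \/ A r j = d x r.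
    have := no_neg j; have [|ajs] := ternaryP r j tA; first by left.
    by case: ajs (d_sign r xs) => -> [] -> //; right.
  have [z /eqP Az|no0] := pickP (fun j => A r j == 0); [left | right] => j.
    have Aj : j != z -> A r j = d x r.
      by have [/zero_unique/(_ Az) ->|//] := A0d j; rewrite eqxx.
    have [z0|z0] := eqVneq (z : nat) 0%N.
      have [j0|j0] := eqVneq (j : nat) 0%N; last by rewrite Aj // -val_eqE /= z0.
      by rewrite (_ : j = z) //; apply: val_inj; rewrite /= j0 z0.
    have Ac0 : A r col0 = d x r.
      have [/zero_unique/(_ Az) cz|//] := A0d col0.
      by case/eqP: z0; rewrite -cz.
    have lt0z : (ix col0 col0 < ix col0 z)%N by apply: ltn_ix_inner; rewrite lt0n.
    (* A zero after the first column would sit between two entries [d x r]. *)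
    have := convex (ix i0 r) _ _ _ _ (d_sign r xs) lt0z (lt01 z col0).
    rewrite !rowi0 rowi1 Az Ac0 => /(_ erefl erefl) d0.
    by case: (is_sign_neq0 (d_sign r xs)).
  by have [/eqP|//] := A0d j; rewrite no0.
move=> Arj; have dr : d x r = -1.
  have [dr|//] := d_sign r xs.
  by case: (decr (ix i0 r) _ _ (lt01 j col0)); rewrite ?rowi0 ?rowi1 ?Arj dr.
rewrite dr opprK in Arj.
have Ar0 : A r col0 = 1.
  have [j0|j0] := eqVneq (j : nat) 0%N.
    by rewrite -Arj; congr (A r _); apply: val_inj.
  have lt0j : (ix col0 col0 < ix col0 j)%N by apply: ltn_ix_inner; rewrite lt0n.
  rewrite -(rowi0 r); apply: prefix lt0j (lt01 j col0) _ _.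
    by rewrite rowi0.
  by rewrite rowi1.
have ltc : (ix col0 col0 < ix col0 col1)%N by apply: ltn_ix_inner.
have di0 : d x i0 = x.
  have := d_sign i0 xs; case: (xs) => x1 [] di0; rewrite di0 x1 //.
    have := prefix (ix i0 i0) _ _ _ ltc (lt01 col1 col0).
    by rewrite !rowi0 rowi1 di0 Ai00 Ai01 => /(_ x1 erefl).
  case: (decr (ix i0 i0) _ _ (lt01 col1 col0)); first by rewrite rowi0 Ai01.
  by rewrite rowi1.
(* Row [(i0, i0)] is pure: a zero followed only by [x]. No mixed row may have both its signs after
   the first column. *)
have row00 j' c : (ix col0 col0 < ix j' c)%N -> phi A B C A (ix i0 i0) (ix j' c) = x.
  rewrite /= => lt0; have [j0|j0] := eqVneq (j' : nat) 0%N.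
    have -> : j' = col0 by apply: val_inj.
    by rewrite rowi0 Ai0; case: eqP lt0 => //; rewrite j0 /= => ->.
  by rewrite (phi_signE _ _ xs) // Ai0 (negbTE j0).
have Ar1 : A r col1 <> 1.
  move=> Ar1; apply: (mixed_pure (ix i0 r) (ix i0 i0) (ix col0 col1) (ix col1 col0) x) => //.
  - by rewrite rowi0.
  - by rewrite rowi1.
  - exact: row00.
  - exact: row00.
have wE c : phi A B C A (ix r i0) (ix col0 c) = d 1 i0.
  by rewrite (phi_signE _ _ _ Ar0) //; left.
have s1 : is_sign 1 by left.
have sN1 : is_sign (-1) by right.
have w_sign : is_sign (phi A B C A (ix r i0) (ix col1 col1)).
  have [Ar1_0|[//|Ar1_N]] := ternaryP r col1 tA.
    by rewrite phi0E // Ai01.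
  by rewrite (phi_signE _ _ sN1 Ar1_N); apply: d_sign.
(* Row [(r, i0)] starts with a block constantly [d 1 i0]. Repeating this sign in the second block
   conflicts with the mixed row [(i0, r)]; changing it breaks decrease or conflicts with the pure
   row [(i0, i0)]. *)
have [w_eq|w_neq] := eqVneq (phi A B C A (ix r i0) (ix col1 col1)) (d 1 i0).
  apply: (mixed_pure (ix i0 r) (ix r i0) (ix col0 col0) (ix col1 col1) _ (d_sign i0 s1)).
  - by rewrite rowi0.
  - by rewrite rowi1.
  - exact: wE.
  - exact: w_eq.
have := d_sign i0 s1; case: (w_sign) w_neq => w + [] d1; rewrite w d1 // => _.
  by apply: (decr (ix r i0) _ _ (lt01 col0 col1)); rewrite ?wE ?d1.
apply: (mixed_pure (ix r i0) (ix i0 i0) (ix col0 col1) (ix col1 col1) x) => //.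
- by rewrite wE.
- exact: row00.
- exact: row00.
Qed.

(* With a zero strictly inside row [i0], row [(i0, i0)] of [phi A] is
   [1^(zn+z) 0 (-1)^*], which forces the position of the sign change in every
   other mixed row of [phi A]. *)
Lemma inner_zero_rows i0 (z : 'I_n) :
    A i0 z = 0 -> (0 < z)%N -> (z < n.-1)%N ->
  forall r, [/\ forall j : 'I_n,
                  A r j = if (j < z)%N then 1 else if j == z :> nat then 0 else -1,
                d 1 r = 1 & d (-1) r = -1].
Proof.
move=> Ai0z z_gt0 z_lt; have [decr1 convex1 _ _ _ _] := gA.
have [decr _ _ _ mixed_pure mixed_mixed] := gA2.
have s1 : is_sign 1 by left.
have sN1 : is_sign (-1) by right.
have Ai0 (j : 'I_n) : A i0 j = if (j < z)%N then 1 else if j == z :> nat then 0 else -1.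
  have sgnl (k : 'I_n) : k != z -> is_sign (A i0 k).
    by have [/zero_unique/(_ Ai0z) ->|//] := ternaryP i0 k tA; rewrite eqxx.
  (* Equal signs around the zero contradict convexity; -1 before 1 contradicts decrease. *)
  have lr (k l : 'I_n) : (k < z)%N -> (z < l)%N -> A i0 k = 1 /\ A i0 l = -1.
    move=> kz zl; have kl := ltn_trans kz zl.
    have /sgnl ks : k != z by rewrite -val_eqE /= ltn_eqF.
    have /sgnl ls : l != z by rewrite -val_eqE /= gtn_eqF.
    have := convex1 i0 _ _ _ _ ks kz zl erefl; rewrite Ai0z.
    have := decr1 i0 _ _ kl.
    case: ks ls => -> [] -> // F E; first by have := E erefl.
      by case: F.
    by have := E erefl.
  case: ltngtP => [jz|zj|/val_inj -> //].
    have last_lt : (n.-1 < n)%N by rewrite ltn_predL ltnW.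
    by have [] := lr j (Ordinal last_lt) jz z_lt.
  by have [] := lr col0 j z_gt0 zj.
have zl_lt : (z.-1 < n)%N by lia.
have zr_lt : (z.+1 < n)%N by lia.
have last_lt : (n.-1 < n)%N by lia.
pose zl := Ordinal zl_lt; pose zr := Ordinal zr_lt; pose cN := Ordinal last_lt.
have rowl s (j c : 'I_n) : (j < z)%N -> phi A B C A (ix i0 s) (ix j c) = d 1 s.
  by move=> jz; apply: phi_signE => //; rewrite Ai0 jz.
have rowz s c : phi A B C A (ix i0 s) (ix z c) = A s c by apply: phi0E.
have rowr s (j c : 'I_n) : (z < j)%N -> phi A B C A (ix i0 s) (ix j c) = d (-1) s.
  by move=> zj; apply: phi_signE => //; rewrite Ai0 ltnNge (ltnW zj) gtn_eqF.
have A0 : A i0 col0 = 1 by rewrite Ai0 z_gt0.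
have AN : A i0 cN = -1 by rewrite Ai0 ltnNge (ltnW z_lt) gtn_eqF.
have lt0z (c c' : 'I_n) : (ix col0 c < ix z c')%N by apply: ltn_ix_block.
have ltzN (c c' : 'I_n) : (ix z c < ix cN c')%N by apply: ltn_ix_block.
have d1_i0 : d 1 i0 = 1.
  have [//|d1] := d_sign i0 s1.
  by case: (decr (ix i0 i0) _ _ (lt0z col0 col0)); rewrite ?rowz ?rowl.
have dN1_i0 : d (-1) i0 = -1.
  have [d1|//] := d_sign i0 sN1.
  by case: (decr (ix i0 i0) _ _ (ltzN cN cN)); rewrite ?rowz ?rowr.
have e0 : phi A B C A (ix i0 i0) (ix col0 col0) = 1 by rewrite rowl.
have eN : phi A B C A (ix i0 i0) (ix cN cN) = -1 by rewrite rowr.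
(* Row [(i0, i0)] already has -1 at [(z, zr)] and 1 at [(z, zl)]. Two mixed rows cannot change sign
   one after the other, so [w] must change sign around the same place. *)
have mixed_row w : phi A B C A w (ix col0 col0) = 1 ->
    phi A B C A w (ix cN cN) = -1 ->
    (forall k : 'I_(n * n), (ix z zr <= k)%N -> phi A B C A w k <> 1) /\
    (forall k : 'I_(n * n), (k <= ix z zl)%N -> phi A B C A w k <> -1).
  move=> w0 wN; split=> k le_k wk.
    apply: (mixed_mixed (ix i0 i0) w _ _ _ _ le_k e0 _ wk wN).
    by rewrite rowz Ai0 /= ltnNge leqnSn gtn_eqF.
  apply: (mixed_mixed w (ix i0 i0) _ _ _ _ le_k w0 wk _ eN).
  by rewrite rowz Ai0 /= ltn_predL z_gt0.
move=> r.
(* Row [(i0, r)] begins with [d 1 r] and ends with [d (-1) r]; equal values would conflict with the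
   mixed row [(i0, i0)]. *)
have [d1 dN1] : d 1 r = 1 /\ d (-1) r = -1.
  have q0 := rowl r col0 col0 z_gt0; have qN := rowr r cN cN z_lt.
  have := mixed_pure (ix i0 i0) (ix i0 r) _ _ _ (d_sign r s1) e0 eN q0.
  have := decr (ix i0 r) _ _ (ltn_trans (lt0z col0 col0) (ltzN col0 cN)).
  rewrite q0 qN; case: (d_sign r s1) => ->; case: (d_sign r sN1) => -> //.
  by move=> /(_ erefl erefl).
have [Aneq1 AneqN1] : (forall j : 'I_n, (z < j)%N -> A r j <> 1) /\
                      (forall j : 'I_n, (j < z)%N -> A r j <> -1).
  have [||q1 qN1] := mixed_row (ix i0 r); [by rewrite rowl | by rewrite rowr |].
  split=> j zj; rewrite -(rowz r); [apply: q1 | apply: qN1].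
    by rewrite /= leq_add2l.
  by rewrite /= leq_add2l; lia.
have row0 j c : A r j = 0 -> phi A B C A (ix r i0) (ix j c) = A i0 c by apply: phi0E.
have row1 j c : A r j = 1 -> phi A B C A (ix r i0) (ix j c) = 1.
  by move=> /(phi_signE _ _ s1) ->.
have rowN1 j c : A r j = -1 -> phi A B C A (ix r i0) (ix j c) = -1.
  by move=> /(phi_signE _ _ sN1) ->.
(* In row [(r, i0)] a zero of row [r] becomes a copy of row [i0], which contains both signs. A zero
   away from [z], or a sign at [z], thus puts a sign on the wrong side of the change. *)
have [||w1 wN1] := mixed_row (ix r i0).
- by have [/row0 ->|[/row1 ->|/(AneqN1 col0 z_gt0)]] := ternaryP r col0 tA.
- by have [/row0 ->|[/(Aneq1 cN z_lt)|/rowN1 ->]] := ternaryP r cN tA.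
split=> // j; case: (ltngtP j z) => [jz|zj|/val_inj -> {j}].
- have [Aj|[//|/(AneqN1 _ jz) []]] := ternaryP r j tA.
  case: (wN1 (ix j cN)); last by rewrite row0.
  exact/ltnW/ltn_ix_block.
- have [Aj|[/(Aneq1 _ zj) []|//]] := ternaryP r j tA.
  case: (w1 (ix j col0)); last by rewrite row0.
  exact/ltnW/ltn_ix_block.
- have [//|[Az|Az]] := ternaryP r z tA.
    by case: (w1 (ix z cN)); [rewrite /= leq_add2l | rewrite row1].
  by case: (wN1 (ix z col0)); [rewrite /= leq_add2l | rewrite rowN1].
Qed.

(** When the zero is at an end, two different signs elsewhere would violate decrease or, by forcing
    a sign at the zero, the prefix or suffix condition. *)
Lemma zero_position i0 (z : 'I_n) : A i0 z = 0 ->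
  (exists left x, is_sign x /\ end_zero_row left A i0 x) \/ (0 < z < n.-1)%N.
Proof.
move=> Az; have [decr _ prefix suffix _ _] := gA.
have sgn (k : 'I_n) : k != z :> nat -> is_sign (A i0 k).
  by have [/zero_unique/(_ Az) ->|//] := ternaryP i0 k tA; rewrite eqxx.
have same left (k l : 'I_n) : z = zero_end left n :> nat -> (k < l)%N ->
    k != z :> nat -> l != z :> nat -> A i0 k = A i0 l.
  move=> zE kl kz lz; have := decr i0 _ _ kl.
  have [zk|lz'] : (z < k)%N \/ (l < z)%N.
    by case: left zE => /= zE; [left | right]; have := ltn_ord l; lia.
  - have := prefix i0 z k l zk kl; rewrite Az.
    case: (sgn k kz) => ->; case: (sgn l lz) => -> //.
      by move=> /(_ erefl erefl).
    by move=> _ /(_ erefl erefl).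
  - have := suffix i0 k l z kl lz'; rewrite Az.
    case: (sgn k kz) => ->; case: (sgn l lz) => -> //.
      by move=> /(_ erefl erefl).
    by move=> _ /(_ erefl erefl).
have [z_in|z_out] := boolP (0 < z < n.-1)%N; [by right | left].
have [left zE] : exists left, z = zero_end left n :> nat.
  have [z0|z0] := eqVneq (z : nat) 0%N; [exists true | exists false] => //=.
  by have := ltn_ord z; move: z_out z0; lia.
(* Read as a number, [left] is column 1 if the zero is first and column 0 if it is last, hence never
   the zero. *)
have left_lt : (left < n)%N by case: left {zE}; rewrite //= ltnW.
pose k := Ordinal left_lt.
have kz : k != z :> nat by rewrite zE /k /=; case: left {zE left_lt k} => //=; lia.
exists left, (A i0 k); split; first exact: sgn.
move=> j; rewrite -zE; case: eqVneq => [/val_inj -> //|jz].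
case: (ltngtP j k) => [jk|kj|/val_inj -> //]; first exact: (same left).
by apply/esym/(same left).
Qed.

End Necessity.

Lemma end_zero_rows m n (A B C : 'M[int]_(m, n)) (d : int -> 'I_m -> int) :
    (1 < n)%N -> ternary A ->
    (forall y r c, is_sign y -> image_block A B C y r c = d y r) ->
    (forall y r, is_sign y -> is_sign (d y r)) ->
    (forall i j j', A i j = 0 -> A i j' = 0 -> j = j') -> good (phi A B C A) ->
  forall left x i0, is_sign x -> end_zero_row left A i0 x ->
  forall r, end_zero_row left A r (d x r) \/ const_row A r (d x r).
Proof.
move=> n_gt1 tA blockE d_sign zero_unique gA2 [|] x i0 xs Ai0 r.
  exact: first_zero_rows gA2 _ _ xs Ai0 r.
have tA' := ternary_reverse tA.
have rev0 (j : 'I_n) : (rev_ord j == n.-1 :> nat) = (j == 0%N :> nat).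
  by have := ltn_ord j; rewrite /=; lia.
have revE i y : end_zero_row true (reverse_mx A) i (- y) -> end_zero_row false A i y.
  move=> rowi j; have := rowi (rev_ord j); rewrite mxE rev_ordK -rev0 rev_ordK /=.
  by case: ifP => _ /(congr1 -%R); rewrite !opprK // oppr0.
(* The right end follows by reversal; the block signs become [- d (- y) i] because [B] and [C] are
   swapped and negated. *)
have := @first_zero_rows _ _ (reverse_mx A) (reverse_mx C) (reverse_mx B)
  (fun y i => - d (- y) i) n_gt1 tA' _ _ _ _ (- x) i0.
rewrite opprK phi_reverse // => first_rows.
case: (first_rows _ _ _ _ (is_signN xs) _ r).
- move=> y i c ys; rewrite image_block_reverse; last by right.
  by rewrite mxE blockE //; apply: is_signN.
- by move=> y i ys; apply/is_signN/d_sign/is_signN.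
- move=> i j j'; rewrite !mxE => /eqP; rewrite oppr_eq0 => /eqP Aj.
  move=> /eqP; rewrite oppr_eq0 => /eqP /(zero_unique _ _ _ Aj).
  exact: rev_ord_inj.
- exact: good_reverse.
- move=> j; rewrite mxE Ai0 /= -rev0 /=.
  by case: ifP; rewrite ?oppr0.
- by move/revE; left.
- by move=> rowr; right=> j; have := rowr (rev_ord j); rewrite mxE rev_ordK => /oppr_inj.
Qed.

(** * Rows as strings and rows as functions *)

Section Strings.
Variables (m n : nat) (M : 'M[int]_(m, n)) (i : 'I_m).

Lemma row_stringP (f : nat -> int) :
  row_string M i = mkseq f n <-> forall j : 'I_n, M i j = f j.
Proof.
rewrite /row_string; split=> [rowE j | Mf].
  have := congr1 (fun s => nth 0 s j) rowE.
  by rewrite nth_mkseq // (nth_map j) ?size_enum_ord // nth_ord_enum.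
rewrite /mkseq -val_enum_ord -map_comp.
by apply: eq_map => j /=.
Qed.

Lemma nseq_mkseq (y : int) : nseq n y = mkseq (fun=> y) n.
Proof.
apply: (@eq_from_nth _ 0); rewrite size_nseq ?size_mkseq // => j jn.
by rewrite nth_nseq nth_mkseq // jn.
Qed.

Lemma const_rowP y : row_string M i = nseq n y <-> const_row M i y.
Proof. by rewrite nseq_mkseq; apply: row_stringP. Qed.

Lemma inner_zero_rowP p : (p < n)%N ->
  row_string M i = nseq p 1 ++ 0 :: nseq (n - p - 1) (-1) <->
  forall j : 'I_n, M i j = if (j < p)%N then 1 else if j == p :> nat then 0 else -1.
Proof.
move=> pn.
suff -> : nseq p 1 ++ 0 :: nseq (n - p - 1) (-1) =
          mkseq (fun j => if (j < p)%N then 1 else if j == p then 0 else -1) n :> seq int.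
  exact: row_stringP.
apply: (@eq_from_nth _ 0); rewrite size_cat /= !size_nseq ?size_mkseq; first by lia.
move=> j jn; rewrite nth_mkseq; last by lia.
rewrite nth_cat size_nseq nth_nseq; case: ltngtP => // [pj|->]; last by rewrite subnn.
by rewrite -[(j - p)%N]prednK /= ?nth_nseq ?subn_gt0 // ifT //; lia.
Qed.

(** For each boolean this reduces to the string function in [left_zero_invariant] or
    [right_zero_invariant]. *)
Definition end_zero_string left y : seq int :=
  if left then 0 :: nseq n.-1 y else rcons (nseq n.-1 y) 0.

Lemma end_zero_rowP left y : (0 < n)%N ->
  row_string M i = end_zero_string left y <-> end_zero_row left M i y.
Proof.
move=> n_gt0.
suff -> : end_zero_string left y =
          mkseq (fun j => if j == zero_end left n then 0 else y) n.
  exact: row_stringP.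
rewrite /end_zero_string; apply: (@eq_from_nth _ 0).
  by case: left; rewrite ?size_rcons /= size_nseq size_mkseq prednK.
case: left => j.
  rewrite /= size_nseq prednK // => jn; rewrite nth_mkseq //.
  by case: j jn => //= j jn; rewrite nth_nseq ifT //; lia.
rewrite size_rcons size_nseq prednK // => jn; rewrite nth_mkseq //.
rewrite nth_rcons size_nseq nth_nseq /=; case: ltngtP => //; lia.
Qed.

End Strings.

(** * Invariance expressed through block signs *)

Section Invariance.
Variables (m n : nat) (A B C : 'M[int]_(m, n)).
Hypothesis n_gt1 : (1 < n)%N.

(** Column [left], read as a number, avoids the zero since [n > 1], so its entry is the sign of the
    row. *)
Lemma end_or_const_inj left m' (M : 'M[int]_(m', n)) i y y' :
    end_zero_row left M i y \/ const_row M i y ->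
    end_zero_row left M i y' \/ const_row M i y' ->
  y = y'.
Proof.
have left_lt : (left < n)%N by case: left; rewrite //= ltnW.
have MiE x : end_zero_row left M i x \/ const_row M i x -> M i (Ordinal left_lt) = x.
  by case=> ->; rewrite //= ifF //; case: left {left_lt} => //=; lia.
by move=> /MiE <- /MiE.
Qed.

(** Each row of [A] has a unique sign, and compatibility says that the same row of [D] carries
    it. *)
Lemma sign_compatibleP left (D : 'M[int]_(m, n)) e :
    (forall r c, D r c = e r) -> (forall r, is_sign (e r)) ->
    (forall r, exists2 y, is_sign y & end_zero_row left A r y \/ const_row A r y) ->
  sign_compatible A (end_zero_string n left) D <->
  forall r, end_zero_row left A r (e r) \/ const_row A r (e r).
Proof.
move=> De es rowA; have n_gt0 := ltnW n_gt1.
have c0 : 'I_n := Ordinal n_gt0.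
have DP r y : row_string D r = nseq n y <-> e r = y.
  by rewrite const_rowP; split=> [/(_ c0)|<- c]; rewrite De.
have AP r y : row_string A r \in [:: end_zero_string n left y; nseq n y] <->
              end_zero_row left A r y \/ const_row A r y.
  rewrite !inE; split=> [/orP[]/eqP|[]].
  - by move/(end_zero_rowP _ _ _ _ n_gt0); left.
  - by move/const_rowP; right.
  - by move/(end_zero_rowP _ _ _ _ n_gt0) ->; rewrite eqxx.
  - by move/const_rowP ->; rewrite eqxx orbT.
split=> [compat r | compat r].
  have [y ys rowr] := rowA r; suff -> : e r = y by [].
  have [c1 cN1] := compat r; apply/DP; move: rowr => /AP.
  by case: ys => ->.
by split=> /AP rowr; apply/DP; apply: end_or_const_inj (compat r) rowr.
Qed.

(** This form treats both ends and both signs at once; it is what the necessity part yields and what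
    the induction on powers consumes. *)
Lemma zero_invariantP left d :
    (forall y r c, is_sign y -> image_block A B C y r c = d y r) ->
  zero_invariant A B C (end_zero_string n left) <->
  [/\ forall r, exists2 y, is_sign y & end_zero_row left A r y \/ const_row A r y,
      forall y r, is_sign y -> is_sign (d y r)
    & forall x i, is_sign x -> end_zero_row left A i x ->
      forall r, end_zero_row left A r (d x r) \/ const_row A r (d x r)].
Proof.
move=> blockE; have n_gt0 := ltnW n_gt1.
have c0 : 'I_n := Ordinal n_gt0.
have s1 : is_sign 1 by left.
have sN1 : is_sign (-1) by right.
have BE r c : B r c = d 1 r by apply: (blockE 1).
have CE r c : C r c = d (-1) r by apply: (blockE (-1)).
have constE (D : 'M[int]_(m, n)) r e : (forall c, D r c = e) ->
    row_string D r \in [:: nseq n 1; nseq n (-1)] <-> is_sign e.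
  move=> De; rewrite !inE; split=> [/orP[]/eqP/const_rowP/(_ c0)|].
  - by rewrite De; left.
  - by rewrite De; right.
  - by case=> e1; apply/orP; [left|right]; apply/eqP/const_rowP => c; rewrite De.
have rowAP r : row_string A r \in [:: end_zero_string n left 1; nseq n 1;
      end_zero_string n left (-1); nseq n (-1)] <->
    exists2 y, is_sign y & end_zero_row left A r y \/ const_row A r y.
  rewrite !inE; split=> [/or4P[]/eqP|].
  - by move/(end_zero_rowP _ _ _ _ n_gt0); exists 1; [|left].
  - by move/const_rowP; exists 1; [|right].
  - by move/(end_zero_rowP _ _ _ _ n_gt0); exists (-1); [|left].
  - by move/const_rowP; exists (-1); [|right].
  - by case=> _ [] -> [/(end_zero_rowP _ _ _ _ n_gt0)|/const_rowP] ->;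
      rewrite eqxx ?orbT.
split=> [[rowA rowB rowC compB compC]|[rowA d_sign comp]].
  have d_sign y r : is_sign y -> is_sign (d y r).
    by case=> ->; [apply/(constE B r _ (BE r)) | apply/(constE C r _ (CE r))].
  have {}rowA r := (rowAP r).1 (rowA r).
  split=> // _ i [] -> /(end_zero_rowP _ _ _ _ n_gt0) Ai.
    by apply/(sign_compatibleP BE) => //; [move=> r; apply: d_sign | apply: compB; exists i].
  by apply/(sign_compatibleP CE) => //; [move=> r; apply: d_sign | apply: compC; exists i].
split=> [r|r|r|[i]|[i]].
- exact/rowAP.
- by apply/(constE B r _ (BE r))/d_sign.
- by apply/(constE C r _ (CE r))/d_sign.
- move/(end_zero_rowP _ _ _ _ n_gt0) => Ai.
  by apply/(sign_compatibleP BE) => //; [move=> r; apply: d_sign | apply: comp Ai].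
- move/(end_zero_rowP _ _ _ _ n_gt0) => Ai.
  by apply/(sign_compatibleP CE) => //; [move=> r; apply: d_sign | apply: comp Ai].
Qed.

End Invariance.

(** * Powers of the morphism *)

Lemma zero_end_ix left N n (j : 'I_N) (c : 'I_n) :
  (ix j c == zero_end left (N * n) :> nat) =
  (j == zero_end left N :> nat) && (c == zero_end left n :> nat).
Proof.
have := ltn_ord j; have := ltn_ord c; case: left => /= cn jN.
  by rewrite addn_eq0 muln_eq0 -!leqn0; move: cn; lia.
apply/eqP/andP => [jc|[/eqP -> /eqP ->]]; last by nia.
have cn1 : (c : nat) = n.-1.
  have := congr1 (modn^~ n) jc; rewrite modnMDl modn_small //.
  rewrite (_ : (N * n).-1 = N.-1 * n + n.-1)%N; last by nia.
  by rewrite modnMDl modn_small //; lia.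
by split; apply/eqP => //; nia.
Qed.

Section Powers.
Variables (m n : nat) (A B C : 'M[int]_(m, n)).

Lemma IST_None : IST A B C = None <-> forall l, semi_transitive (@Gok m n A B C l).
Proof.
rewrite /IST; case: pselect => [ex_l|nex_l]; split=> //.
  by move=> st; have [l /asboolP[]] := ex_l.
by move=> _ l; apply: contrapT => nst; case: nex_l; exists l; apply/asboolP.
Qed.

Lemma Mpow1E r c : Mpow A B C 1 (ix ord0 r) (ix ord0 c) = A r c.
Proof. by rewrite [LHS]phiE mxE. Qed.

Lemma good_Mpow1 : good (Mpow A B C 1) -> good A.
Proof.
apply: (good_submatrix (g := fun r => ix ord0 r) (f := fun c => ix ord0 c)).
  by move=> i j /=; rewrite !add0n.
by move=> r c; rewrite Mpow1E.
Qed.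

(** The second power has dimensions [1 * m * m] and [1 * n * n]; the maps insert the leading index
    [ord0]. *)
Lemma good_Mpow2 : good (Mpow A B C 2) -> good (phi A B C A).
Proof.
apply: (good_submatrix
  (g := fun i => ix (ix ord0 (mxtens_unindex i).1 : 'I_(1 * m)) (mxtens_unindex i).2)
  (f := fun j => ix (ix ord0 (mxtens_unindex j).1 : 'I_(1 * n)) (mxtens_unindex j).2)).
  by move=> i j /=; rewrite !mul0n !add0n -!divn_eq.
move=> i j; rewrite [RHS]phiE.
by rewrite [X in image_block _ _ _ X]Mpow1E mxE.
Qed.

(** The last clause strengthens the induction: once there are several columns, the sign of a row
    with a zero also occurs in an end-zero row of [A], which makes the compatibility hypothesis
    applicable. *)
Lemma end_zero_Mpow left d :
    (forall y r c, is_sign y -> image_block A B C y r c = d y r) ->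
    (forall y r, is_sign y -> is_sign (d y r)) ->
    (forall r, exists2 y, is_sign y & end_zero_row left A r y \/ const_row A r y) ->
    (forall x i, is_sign x -> end_zero_row left A i x ->
      forall r, end_zero_row left A r (d x r) \/ const_row A r (d x r)) ->
  forall k i, exists2 y, is_sign y & const_row (Mpow A B C k) i y \/
    end_zero_row left (Mpow A B C k) i y /\
    ((1 < powdim n k)%N -> exists i0, end_zero_row left A i0 y).
Proof.
move=> blockE d_sign rowA comp; elim=> [|k IHk] i.
  exists 1; first by left.
  by right; split=> // j; rewrite mxE [j]ord1; case: left {rowA comp}.
case: (mxtens_indexP i) => {}i r; have [y ys Mi] := IHk i.
case: Mi => [Mi|[Mi endA]].
  exists (d y r); first exact: d_sign.
  by left=> j; case: (mxtens_indexP j) => {}j c; rewrite [LHS]phiE Mi blockE.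
have ME j c : Mpow A B C k.+1 (ix i r) (ix j c) =
    if j == zero_end left (powdim n k) :> nat then A r c else d y r.
  by rewrite [LHS]phiE Mi; case: ifP; rewrite // blockE.
(* [x] is the sign of row [r] of [A]. It must match the neighbouring constant blocks, which exist
   only if the previous power has several columns. *)
have {comp rowA} [x [xs Ar d_x]] : exists x, [/\ is_sign x,
    end_zero_row left A r x \/ const_row A r x & (1 < powdim n k)%N -> x = d y r].
  have [/endA[i0 Ai0]|le1] := ltnP 1 (powdim n k).
    by exists (d y r); split=> //; [apply: d_sign | apply: comp ys Ai0 r].
  by have [x xs Ar] := rowA r; exists x.
exists x => //; have {d_x} {}ME j c : Mpow A B C k.+1 (ix i r) (ix j c) =
    if j == zero_end left (powdim n k) :> nat then A r c else x.
  rewrite ME; case: ifP => // jN; rewrite d_x //.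
  have jn : (j < powdim n k)%N by apply: ltn_ord.
  by move: jn jN; case: left {Mi endA ME Ar IHk} => /=; lia.
case: Ar => Ar; [right | left]; last first.
  move=> j; case: (mxtens_indexP j) => {}j c.
  by rewrite [LHS]ME Ar if_same.
split=> [j|_]; last by exists r.
case: (mxtens_indexP j) => {}j c.
by rewrite [LHS]ME Ar [in RHS]zero_end_ix; case: eqP.
Qed.

(** A zero at an end leaves the nonzero entries contiguous. *)
Lemma end_zero_rows_semi_transitive left m' n' (M : 'M[int]_(m', n')) :
    (forall i, exists2 y, is_sign y & const_row M i y \/ end_zero_row left M i y) ->
  semi_transitive (Go M).
Proof.
move=> rowM; apply: Go_pure_convex_semi_transitive => i.
have [y ys Mi] := rowM i; exists y; split=> // [j|i' j k /andP[ij jk] _ _].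
  case: Mi => Mi; first by right.
  by rewrite Mi; case: ifP; [left | right].
case: Mi => -> //; rewrite ifF //; have := ltn_ord k.
by case: left {rowM} => /=; lia.
Qed.

(** The zero at [s] becomes a copy of [A] with its zero at [s * n + p]; blocks before it are all 1,
    blocks after it all -1. *)
Lemma inner_zero_Mpow p : (p < n)%N ->
    (forall r (j : 'I_n), A r j = if (j < p)%N then 1 else if j == p :> nat then 0 else -1) ->
    B = const_mx 1 -> C = const_mx (-1) ->
  forall k, exists s, forall i (j : 'I_(powdim n k)), Mpow A B C k i j =
    if (j < s)%N then 1 else if j == s :> nat then 0 else -1.
Proof.
move=> pn AE BE CE; elim=> [|k [s IHk]].
  by exists 0%N => i j; rewrite mxE [j]ord1.
exists (s * n + p)%N => i j.
have [j0 [c ->]] : exists (j0 : 'I_(powdim n k)) (c : 'I_n), j = ix j0 c.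
  by case: (mxtens_indexP j) => j0 c; exists j0, c.
case: (mxtens_indexP i) => {}i r {j}.
rewrite [LHS]phiE IHk; have cn := ltn_ord c; case: ltngtP => [js|sj|js] /=.
- by rewrite /image_block /= BE mxE ifT //; nia.
- rewrite /image_block /= CE mxE ifF; last by nia.
  by rewrite ifF //; apply/negbTE/eqP; nia.
- by rewrite image_block0 AE js ltn_add2l eqn_add2l.
Qed.

End Powers.

(** * Characterization of the triples with infinite index *)

Theorem theorem3p24 (m n : nat) (A B C : 'M[int]_(m, n))
    (tA : ternary A) (tB : ternary B) (tC : ternary C)
    (A_has_0 : exists i j, A i j = 0)
    (not_indep_B : ~ independent_from_B A C)
    (not_indep_C : ~ independent_from_C A B)
    (nlA : ~ layered A) (lB : layered B) (lC : layered C) :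
  IST A B C = None <->
  [\/ left_zero_invariant A B C,
      right_zero_invariant A B C
    | exists p : nat,
        [/\ (1 <= p <= n - 2)%N,
            forall i, row_string A i = nseq p 1 ++ 0 :: nseq (n - p - 1) (-1),
            B = const_mx 1
          & C = const_mx (-1)]].
Proof.
have n_gt1 : (1 < n)%N.
  rewrite ltnNge; apply/negP => n_le1; case: nlA => i j j'; congr (A i _).
  by apply: val_inj => /=; have := ltn_ord j; have := ltn_ord j'; lia.
have n_gt0 := ltnW n_gt1.
pose c0 : 'I_n := Ordinal n_gt0; pose c1 : 'I_n := Ordinal n_gt1.
(* For a sign [y] the block is layered, so any column could replace [c0]. *)
pose d y r := image_block A B C y r c0.
have s1 : is_sign 1 by left.
have sN1 : is_sign (-1) by right.
have blockE y r c : is_sign y -> image_block A B C y r c = d y r.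
  by case=> ->; [apply: lB | apply: lC].
have leftP := zero_invariantP n_gt1 true blockE.
have rightP := zero_invariantP n_gt1 false blockE.
rewrite IST_None; split=> [st | inv].
  have gM k : good (Mpow A B C k) by apply: semi_transitive_good.
  have gA := good_Mpow1 (gM 1); have gA2 := good_Mpow2 (gM 2).
  have zM k i j j' : Mpow A B C k i j = 0 -> Mpow A B C k i j' = 0 -> j = j'.
    exact: good_phi_unique_zero tA nlA (gM k.+1).
  have zA : forall i j j', A i j = 0 -> A i j' = 0 -> j = j'.
    by move=> i j j'; apply: good_phi_unique_zero tA nlA gA2.
  (* If [y] occurs in a power, a zero row in its block would give at least two zeros in one row of
     the next power. *)
  have d_neq0 k i j y : Mpow A B C k i j = y -> is_sign y -> forall r, is_sign (d y r).
    move=> Mij ys r.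
    have [d0|//] : d y r = 0 \/ is_sign (d y r).
      by case: ys => ->; [apply: (ternaryP r c0 tB) | apply: (ternaryP r c0 tC)].
    have M0 c : Mpow A B C k.+1 (ix i r) (ix j c) = 0.
      by rewrite [LHS]phiE Mij blockE.
    have /(congr1 (@mxtens_unindex _ _)) := zM _ _ _ _ (M0 c0) (M0 c1).
    by rewrite !mxtens_indexK => -[].
  have [i1 [j1 A1s]] : exists i j, is_sign (A i j).
    apply: contrapT => nex; case: nlA => i j j'.
    have A0 c : A i c = 0 by have [//|As] := ternaryP i c tA; case: nex; exists i, c.
    by rewrite !A0.
  (* This is the failure of independence: 1 occurs in [A] or [C], and -1 occurs in [A] or [B]. *)
  have occurs y : is_sign y -> (exists i j, A i j = y) \/ (exists r, d (- y) r = y).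
    case=> ->; apply: contrapT => nex.
      case: not_indep_B; split=> [i j Aij|r c Crc]; case: nex.
        by left; exists i, j.
      by right; exists r; rewrite -(blockE _ r c).
    case: not_indep_C; split=> [i j Aij|r c Brc]; case: nex.
      by left; exists i, j.
    by right; exists r; rewrite -(blockE _ r c).
  (* Each sign [y] occurs in the first or second power: if [A] lacks it, [A] contains [- y], whose
     block contains [y]. *)
  have d_sign y r : is_sign y -> is_sign (d y r).
    move=> ys; have [[i [j Aij]]|[r0 dr0]] := occurs y ys.
      exact: d_neq0 (etrans (Mpow1E _ _ _ _ _) Aij) ys r.
    have [A1|A1] : A i1 j1 = y \/ A i1 j1 = - y.
      by case: A1s ys => -> [] ->; rewrite ?opprK; auto.
      exact: d_neq0 (etrans (Mpow1E _ _ _ _ _) A1) ys r.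
    apply: (d_neq0 2%N (ix (ix ord0 i1 : 'I_(1 * m)) r0) (ix (ix ord0 j1 : 'I_(1 * n)) c0)) ys r.
    by rewrite [LHS]phiE [X in image_block _ _ _ X]Mpow1E A1.
  have [i0 [z Az]] := A_has_0.
  have [[left [x [xs Ai0]]]|/andP[z_gt0 z_lt]] := zero_position n_gt1 tA zA gA Az.
    have inv : [/\ forall r, exists2 y, is_sign y & end_zero_row left A r y \/ const_row A r y,
        forall y r, is_sign y -> is_sign (d y r)
      & forall x i, is_sign x -> end_zero_row left A i x ->
        forall r, end_zero_row left A r (d x r) \/ const_row A r (d x r)].
      have rowA := end_zero_rows n_gt1 tA blockE d_sign zA gA2.
      split=> // [r|y i ys Ai]; last exact: rowA ys Ai.
      by exists (d x r); [apply: d_sign | apply: rowA xs Ai0 r].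
    by case: left {Ai0} inv => [/leftP|/rightP]; [constructor 1 | constructor 2].
  have rowA := inner_zero_rows n_gt1 tA blockE d_sign zA gA gA2 Az z_gt0 z_lt.
  constructor 3; exists z; split.
  - by rewrite z_gt0; lia.
  - by move=> i; apply/inner_zero_rowP => //; have [] := rowA i.
  - by apply/matrixP=> i j; rewrite mxE (blockE 1) //; have [] := rowA i.
  - by apply/matrixP=> i j; rewrite mxE (blockE (-1)) //; have [] := rowA i.
move=> k; case: inv => [/leftP|/rightP|[p [p_in rowA BE CE]]].
- case=> rowA d_sign comp; apply: (@end_zero_rows_semi_transitive true) => i.
  have [y ys [Mi|[Mi _]]] := end_zero_Mpow blockE d_sign rowA comp i; exists y => //.
    by left.
  by right.
- case=> rowA d_sign comp; apply: (@end_zero_rows_semi_transitive false) => i.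
  have [y ys [Mi|[Mi _]]] := end_zero_Mpow blockE d_sign rowA comp i; exists y => //.
    by left.
  by right.
have pn : (p < n)%N by lia.
have AE r := (inner_zero_rowP A r pn).1 (rowA r).
have [s Ms] := inner_zero_Mpow pn AE BE CE k.
exact: Go_const_rows_semi_transitive Ms.
Qed.
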